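(* Let $\alpha\in[\frac45,1]$ and $\beta\in(0,\alpha)$, and set $$R_4=\frac{(1+2\alpha-\beta)-\sqrt{(\beta-2\alpha-1)^2-8(\alpha-\beta)}}{4}.$$ Then $R_4<\frac12$, and for every $f\in\mathcal{BA}(\mathbb{D})$ it holds that $$\alpha|f(z)|+\beta\sum_{k=1}^{\infty}\left|\frac{f^{(k)}(z)}{k!}\right||z|^k\le 1\qquad\text{for all } z\in\mathbb{D}\text{ with }|z|=r\le R_4.$$
   Context: $\mathbb{D}=\{z\in\mathbb{C}:|z|<1\}$. $\mathcal{BA}(\mathbb{D})$ is the class of analytic functions $f$ on $\mathbb{D}$ with $|f(z)|<1$ for all $z\in\mathbb{D}$. $f^{(k)}$ denotes the $k$-th derivative of $f$. *)

(* Defs.v *)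
From mathcomp Require Import all_boot all_order all_algebra.
From mathcomp.real_closed Require Import complex.
From mathcomp Require Import all_classical all_reals all_analysis.
Import Order.TTheory GRing.Theory Num.Theory.
Import numFieldNormedType.Exports.

Set Implicit Arguments.
Unset Strict Implicit.
Unset Printing Implicit Defensive.

Local Open Scope ring_scope.
Local Open Scope classical_set_scope.

(* [R[i]] seen as a [numFieldType]: this is what gives it, through
   [numFieldNormedType], its topology and its structure of normed space over
   itself, so that [derive1n] below is the complex derivative. *)
Definition C (R : realType) : numFieldType := R[i].

(* The modulus as an element of [R]; the norm [`|z|] of [C R] is the same
   number seen in [C R]. *)
Definition cmod (R : realType) (z : C R) : R := ComplexField.Normc.normc z.

Definition unit_disc (R : realType) : set (C R) := [set z | cmod z < 1].

Definition analytic_at (R : realType) (f : C R -> C R) (z0 : C R) : Prop :=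
  exists (a : nat -> C R) (rho : R), 0 < rho /\
    forall z : C R, cmod (z - z0) < rho ->
      [series a k * (z - z0) ^+ k]_k @ \oo --> f z.

(* Functions on the disc are represented by total functions, whose values
   outside the disc are irrelevant. *)
Definition BA (R : realType) : set (C R -> C R) :=
  [set f | (forall z, unit_disc z -> analytic_at f z) /\
           (forall z, unit_disc z -> cmod (f z) < 1)].

Definition R4 (R : realType) (alpha beta : R) : R :=
  ((1 + 2 * alpha - beta)
    - Num.sqrt ((beta - 2 * alpha - 1) ^+ 2 - 8 * (alpha - beta))) / 4.

(* Main.v *)
Require Import Defs.
From mathcomp Require Import all_boot all_order all_algebra.
From mathcomp Require Import cyclic separable cyclotomic ring lra.
From mathcomp.real_closed Require Import complex.
From mathcomp Require Import all_classical all_reals all_analysis.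
Import Order.TTheory GRing.Theory Num.Theory.
Import numFieldNormedType.Exports.
Local Open Scope ring_scope.
Local Open Scope classical_set_scope.

(** Write [r = |z|] and [x = |f z|]. The disc of centre [z] and radius [1 - r]
    lies in the unit disc, and [f] is bounded by [1] on it, so the Taylor
    coefficients [a_k] of [f] at [z] satisfy Wiener's inequality
    [|a_k| (1 - r)^k <= 1 - x^2] for [k >= 1] ([coefficient_bound]). Since
    [f^(k)(z) = k! a_k] ([derive1n_expands]), a geometric series bounds the sum
    by [(1 - x^2) r / (1 - 2 r)] when [r < 1/2].

    On the side of the parameters, [R4] is the smaller root of
    [2 t^2 - (1 + 2 alpha - beta) t + (alpha - beta)], which is negative at
    [1/2]; hence [R4 < 1/2], and [r <= R4] gives
    [beta (1 - r) <= (alpha - r) (1 - 2 r)] ([le_R4]). As [alpha <= 1], this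
    gives [beta <= 1 - 2 r], hence [beta r / (1 - 2 r) <= r <= 1/2], and what
    remains is [x + (1 - x^2) / 2 <= 1].

    Wiener's inequality comes from a Schwarz lemma. Averaging
    [h |-> f (z + zeta h)] over the [k]-th roots of unity [zeta] keeps the bound
    and the coefficients of index divisible by [k], and kills the others; the
    average [g] is therefore [a_0 + a_k h^k + ...], and
    [(g - a_0) / (h^k (1 - conj a_0 g))] has modulus at most [rho^(-k)] on the
    circle of radius [rho] and the value [a_k / (1 - |a_0|^2)] at [0]
    ([schwarz_lemma_order]).

    Analyticity is only given locally, by convergent power series, so this rests
    on a maximum principle proved without integration. An analytic function is
    handled through [expands]: Taylor polynomials of every order with a
    geometric bound on the remainder. This form is stable under the operations
    needed here, under differentiation ([expands_derive1]), and reads off the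
    leading term at a point, from which [quotient_local_max] deduces that a
    quotient of analytic functions whose modulus has a local maximum is locally
    constant. Compactness of closed discs then gives
    [quotient_maximum_principle]. *)

Set Implicit Arguments.
Unset Strict Implicit.
Unset Printing Implicit Defensive.

(** * The modulus and the topology of the complex plane *)

Section Modulus.
Variable R : realType.
Implicit Types (x y z : C R).

Lemma norm_cmod z : `|z| = ((cmod z)%:C)%C :> R[i].
Proof. by []. Qed.

Lemma cmod_ge0 z : 0 <= cmod z.
Proof. by case: z => a b; exact: sqrtr_ge0. Qed.
Hint Resolve cmod_ge0 : core.

Lemma cmodM x y : cmod (x * y) = cmod x * cmod y.
Proof. exact: ComplexField.Normc.normcM. Qed.

Lemma cmodV x : cmod x^-1 = (cmod x)^-1.
Proof. exact: ComplexField.Normc.normcV. Qed.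

Lemma cmod0 : cmod (0 : C R) = 0.
Proof. exact: ComplexField.Normc.normc0. Qed.

Lemma cmod1 : cmod (1 : C R) = 1.
Proof. exact: ComplexField.Normc.normc1. Qed.

Lemma cmod_eq0 x : (cmod x == 0) = (x == 0).
Proof.
apply/eqP/eqP => [|->]; last exact: cmod0.
exact: ComplexField.Normc.eq0_normc.
Qed.

Lemma cmod_gt0 x : (0 < cmod x) = (x != 0).
Proof. by rewrite lt_neqAle cmod_ge0 andbT eq_sym cmod_eq0. Qed.

Lemma cmodD x y : cmod (x + y) <= cmod x + cmod y.
Proof. exact: le_normcD. Qed.

Lemma cmodN x : cmod (- x) = cmod x.
Proof. exact: normcN. Qed.

Lemma cmodBC x y : cmod (x - y) = cmod (y - x).
Proof. by rewrite -cmodN opprB. Qed.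

Lemma cmodB x y : cmod (x - y) <= cmod x + cmod y.
Proof. by rewrite (le_trans (cmodD _ _))// cmodN. Qed.

Lemma cmodB_ge x y : cmod x - cmod y <= cmod (x - y).
Proof. by rewrite lerBlDr -{1}(subrK y x) cmodD. Qed.

Lemma cmodX x n : cmod (x ^+ n) = cmod x ^+ n.
Proof.
elim: n => [|n IH]; first by rewrite !expr0 cmod1.
by rewrite !exprS cmodM IH.
Qed.

Lemma cmod_real (t : R) : cmod (t%:C%C : C R) = `|t|.
Proof. by rewrite /cmod /= expr0n addr0 sqrtr_sqr. Qed.

Lemma cmodMn x n : cmod (x *+ n) = cmod x *+ n.
Proof. exact: normcMn. Qed.

Lemma cmod_nat n : cmod (n%:R : C R) = n%:R.
Proof. by rewrite cmodMn cmod1. Qed.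

Lemma cmod_sum (I : Type) (r : seq I) (P : pred I) (F : I -> C R) :
  cmod (\sum_(i <- r | P i) F i) <= \sum_(i <- r | P i) cmod (F i).
Proof.
elim/big_rec2 : _ => [|i s t _ h]; first by rewrite cmod0.
by rewrite (le_trans (cmodD _ _))// lerD2l.
Qed.

Lemma gt0_real_complex (e : C R) : 0 < e -> exists t : R, e = (t%:C)%C.
Proof.
move=> e0; exists (complex.Re e); have := gtr0_real e0.
by case: (e) => a b /=; rewrite complex_real => /eqP /= ->.
Qed.

(** Radii in [C R] are the nonnegative elements of [R[i]], hence real: this
    is what allows every estimate below to be carried out in [R]. *)
Lemma cvg_cmod (T : Type) (F : set_system T) {FF : Filter F}
    (f : T -> C R) l :
  f x @[x --> F] --> l <->
  (forall e : R, 0 < e -> \forall x \near F, cmod (l - f x) < e).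
Proof.
split=> [/cvgrPdist_lt h e e0|h].
  have e0' : 0 < (e%:C%C : C R) by rewrite /= ltcR.
  have := h _ e0'; apply: filterS => x.
  by rewrite /= norm_cmod ltcR.
apply/cvgrPdist_lt => e e0.
have [e' ee'] := gt0_real_complex e0.
move: e0; rewrite ee' => e0.
have {}e0 : 0 < e' by rewrite -ltcR.
have := h _ e0; apply: filterS => x.
by rewrite norm_cmod ltcR.
Qed.

Lemma nbhs_cmod z (P : set (C R)) :
  nbhs z P <-> exists2 e : R, 0 < e & forall w, cmod (w - z) < e -> P w.
Proof.
split.
  rewrite -nbhs_ballE => -[e /= e0 h].
  have [e' ee'] := gt0_real_complex e0.
  exists e'; first by rewrite -ltcR -ee'.
  move=> w hw; apply: h; rewrite /= -ball_normE /= norm_cmod ee' ltcR cmodBC //.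
move=> [e e0 h]; rewrite -nbhs_ballE; exists (e%:C)%C => /=; first by rewrite ltcR.
move=> w; rewrite -ball_normE /= norm_cmod ltcR cmodBC; exact: h.
Qed.

End Modulus.
#[local] Hint Extern 0 (is_true (0 <= cmod _)) => exact: cmod_ge0 : core.

(** * Taylor expansions with geometric remainder bounds *)

Section Expansion.
Variable R : realType.
Implicit Types (a b : nat -> C R) (f g : C R -> C R) (z w h c : C R).

(** Taken for all [N], the bound with a single [K] encodes at once that [a]
    grows at most geometrically and that [f] is the sum of the power series near
    [z], while every estimate stays a statement about finite sums. *)
Definition expands a f z :=
  exists2 K : R, 0 < K & forall h, K * cmod h <= 1 -> forall N : nat,
    cmod (f (z + h) - \sum_(n < N) a n * h ^+ n) <= K * (K * cmod h) ^+ N.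

Lemma expands_bound_mono (K L : R) h (N : nat) : 0 <= K -> K <= L ->
  K * (K * cmod h) ^+ N <= L * (L * cmod h) ^+ N.
Proof.
move=> K0 KL; apply: ler_pM => //.
  by rewrite exprn_ge0// mulr_ge0.
by apply: lerXn2r; rewrite ?nnegrE ?mulr_ge0// ?(le_trans K0)// ler_wpM2r.
Qed.

Lemma expands_eq a b f g z : a =1 b -> (\forall w \near z, f w = g w) ->
  expands a f z -> expands b g z.
Proof.
move=> ab /nbhs_cmod[e e0 fg] [K K0 hK].
have L0 : 0 < 2 / e by rewrite divr_gt0.
exists (K + 2 / e); first by rewrite addr_gt0.
move=> h; rewrite mulrDl => hh N.
have p1 : 0 <= K * cmod h by rewrite mulr_ge0// ltW.
have p2 : 0 <= 2 / e * cmod h by rewrite mulr_ge0// ltW.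
rewrite -fg; last first.
  have h1 : 2 / e * cmod h <= 1 by lra.
  rewrite addrAC subrr add0r.
  have : e * (2 / e * cmod h) <= e * 1 by rewrite ler_wpM2l// ltW.
  have -> : e * (2 / e * cmod h) = 2 * cmod h by field; rewrite gt_eqF.
  by have := cmod_ge0 h; lra.
under eq_bigr do rewrite -ab.
apply: le_trans (hK _ _ N) _; first by lra.
by rewrite -mulrDl; apply: expands_bound_mono; lra.
Qed.

Lemma expands_at a f z : expands a f z -> f z = a 0.
Proof.
move=> [K K0 hK]; apply/eqP; rewrite -subr_eq0 -cmod_eq0.
rewrite eq_le cmod_ge0 andbT.
have := hK 0; rewrite cmod0 mulr0 => /(_ ler01 1%N).
by rewrite big_ord1 expr0 mulr1 addr0 expr1 mulr0.
Qed.

Lemma expandsD a b f g z : expands a f z -> expands b g z ->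
  expands (fun n => a n + b n) (fun w => f w + g w) z.
Proof.
move=> [K K0 hK] [L L0 hL]; exists (K + L); first exact: addr_gt0.
move=> h; rewrite mulrDl => hh N.
have p1 : 0 <= K * cmod h by rewrite mulr_ge0// ltW.
have p2 : 0 <= L * cmod h by rewrite mulr_ge0// ltW.
rewrite (eq_bigr (fun n : 'I_N => a n * h ^+ n + b n * h ^+ n)); last first.
  by move=> n _; rewrite mulrDl.
rewrite big_split /= opprD addrACA.
apply: le_trans (cmodD _ _) _; rewrite [leRHS]mulrDl.
apply: lerD.
  apply: le_trans (hK _ _ N) _; first by lra.
  by rewrite ler_wpM2l ?(ltW K0)// lerXn2r ?nnegrE ?addr_ge0//; lra.
apply: le_trans (hL _ _ N) _; first by lra.
by rewrite ler_wpM2l ?(ltW L0)// lerXn2r ?nnegrE ?addr_ge0//; lra.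
Qed.

Lemma expandsZ c a f z : expands a f z ->
  expands (fun n => c * a n) (fun w => c * f w) z.
Proof.
move=> [K K0 hK]; exists (K * (1 + cmod c)).
  by rewrite mulr_gt0// ltr_pwDl.
move=> h hh N.
have KL : K <= K * (1 + cmod c) by rewrite ler_peMr ?(ltW K0)// lerDl.
have hh1 : K * cmod h <= 1.
  by apply: le_trans hh; rewrite ler_wpM2r.
under eq_bigr do rewrite -mulrA.
rewrite -mulr_sumr -mulrBr cmodM.
apply: (@le_trans _ _ (cmod c * (K * (K * cmod h) ^+ N))).
  by rewrite ler_wpM2l// hK.
rewrite mulrA; apply: ler_pM => //.
- by rewrite mulr_ge0 ?(ltW K0).
- by rewrite exprn_ge0// mulr_ge0 ?(ltW K0).
- by rewrite mulrC ler_wpM2l ?(ltW K0)// lerDr.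
- apply: lerXn2r; rewrite ?nnegrE ?mulr_ge0 ?(ltW K0)// ?addr_ge0//.
  by rewrite ler_wpM2r.
Qed.

Lemma expands_cst c z : expands (fun n => if n is 0 then c else 0) (cst c) z.
Proof.
exists (1 + cmod c); first by rewrite ltr_pwDl.
move=> h hh [|N].
  by rewrite big_ord0 subr0 expr0 mulr1 lerDr.
rewrite big_ord_recl /= expr0 mulr1 big1 ?addr0; last first.
  by move=> i _; rewrite mul0r.
rewrite subrr cmod0 mulr_ge0 ?exprn_ge0 ?mulr_ge0 ?addr_ge0//.
Qed.

Lemma expands_sum (I : Type) (r : seq I) (a : I -> nat -> C R)
    (f : I -> C R -> C R) z : (forall i, expands (a i) (f i) z) ->
  expands (fun n => \sum_(i <- r) a i n) (fun w => \sum_(i <- r) f i w) z.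
Proof.
move=> h; elim: r => [|i r IH].
  apply: (expands_eq _ _ (expands_cst 0 z)).
    by move=> [|n]; rewrite big_nil.
  by near=> w; rewrite big_nil.
apply: (expands_eq _ _ (expandsD (h i) IH)).
  by move=> n; rewrite big_cons.
by near=> w; rewrite big_cons.
Unshelve. all: by end_near. Qed.

Lemma expands_mulX a f z : expands a f z ->
  expands (fun n => if n is m.+1 then a m else 0) (fun w => (w - z) * f w) z.
Proof.
move=> [K K0 hK]; exists (K + 1); first by rewrite addr_gt0.
move=> h; rewrite mulrDl => hh N.
have p1 : 0 <= K * cmod h by rewrite mulr_ge0// ltW.
have ch := cmod_ge0 h.
rewrite addrAC subrr add0r.
have {}hK := hK h ltac:(lra).
case: N => [|N].
  rewrite big_ord0 subr0 expr0 mulr1 cmodM.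
  have := hK 0; rewrite big_ord0 subr0 expr0 mulr1 => hK0.
  apply: (@le_trans _ _ (cmod h * K)); first by rewrite ler_wpM2l.
  lra.
rewrite big_ord_recl mul0r add0r.
have -> : \sum_(i < N) a i * h ^+ (bump 0 i) = h * \sum_(i < N) a i * h ^+ i.
  by rewrite mulr_sumr; apply: eq_bigr => i _; rewrite exprS mulrCA.
rewrite -mulrBr cmodM.
apply: (@le_trans _ _ ((K * cmod h) ^+ N.+1)).
  rewrite exprS -mulrA mulrCA ler_wpM2l//; exact: hK.
rewrite -[leLHS]mul1r; apply: ler_pM => //; first by rewrite exprn_ge0.
  lra.
apply: lerXn2r; rewrite ?nnegrE; lra.
Qed.

Lemma expands_mulXn a f z : expands a f z -> forall k : nat,
  exists b, expands b (fun w => w ^+ k * f w) z.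
Proof.
move=> ea; elim=> [|k [b eb]].
  exists a; apply: (expands_eq _ _ ea) => //.
  by near=> w; rewrite expr0 mul1r.
have h := expandsD (expands_mulX eb) (expandsZ z eb).
eexists; apply: (expands_eq _ _ h) => //.
by near=> w; rewrite -mulrDl subrK exprS -mulrA.
Unshelve. all: by end_near. Qed.

Lemma expands_dilate a f p c z : expands a f (p + c * z) -> 
  expands (fun n => a n * c ^+ n) (fun w => f (p + c * w)) z.
Proof.
move=> [K K0 hK]; exists (K * (1 + cmod c)).
  by rewrite mulr_gt0// ltr_pwDl.
move=> h hh N.
have le1 : K * cmod (c * h) <= K * (1 + cmod c) * cmod h.
  rewrite cmodM mulrA ler_wpM2r// ler_wpM2l ?(ltW K0)// lerDr//.
rewrite mulrDr addrA; under eq_bigr do rewrite -mulrA -exprMn.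
apply: le_trans (hK _ _ N) _; first exact: le_trans hh.
apply: ler_pM => //; rewrite ?exprn_ge0 ?mulr_ge0 ?(ltW K0)//.
  by rewrite ler_peMr ?(ltW K0)// lerDl.
by apply: lerXn2r; rewrite ?nnegrE ?mulr_ge0 ?(ltW K0)// addr_ge0.
Qed.

(** Removing a zero of order [k]: the value prescribed at [z] is the one that
    makes the quotient analytic there. The extra term in the constant only
    serves the order [0] remainder at [z] itself. *)
Lemma expands_divXn a f z (k : nat) : expands a f z ->
  (forall n, (n < k)%N -> a n = 0) ->
  expands (fun n => a (n + k)%N)
    (fun w => if w == z then a k else f w / (w - z) ^+ k) z.
Proof.
move=> [K K0 hK] ak; exists (K * (1 + K ^+ k) + `|(cmod (a k))| ).
  by rewrite ltr_pwDl// mulr_gt0// ltr_pwDl// exprn_ge0// ltW.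
move=> h hh N.
have Kk0 : 0 <= K ^+ k by rewrite exprn_ge0// ltW.
have KL : K <= K * (1 + K ^+ k) + `|(cmod (a k))|.
  by rewrite ler_wpDr// ler_peMr ?(ltW K0)// lerDl.
have KL2 : K * K ^+ k <= K * (1 + K ^+ k) + `|(cmod (a k))|.
  by rewrite ler_wpDr// ler_wpM2l ?(ltW K0)// lerDr.
have L0 := le_trans (ltW K0) KL.
rewrite -subr_eq0 addrAC subrr add0r; case: eqVneq => [->|h0].
  case: N => [|N].
    rewrite big_ord0 subr0 expr0 mulr1 ger0_norm// lerDr.
    by rewrite mulr_ge0// ?(ltW K0)// addr_ge0.
  rewrite big_ord_recl expr0 mulr1 big1 ?addr0 ?subrr ?cmod0.
    by rewrite mulr0 expr0n mulr0.
  by move=> i _; rewrite expr0n mulr0.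
have hk0 : 0 < cmod h ^+ k by rewrite exprn_gt0// cmod_gt0.
rewrite -(ler_pM2l hk0) -cmodX -cmodM mulrBr mulrCA divff; last first.
  by rewrite expf_neq0.
rewrite mulr1 mulr_sumr.
have -> : \sum_(i < N) h ^+ k * (a (i + k)%N * h ^+ i)
        = \sum_(n < k + N) a n * h ^+ n.
  rewrite big_split_ord /= [X in _ = X + _]big1 ?add0r; last first.
    by move=> i _; rewrite ak ?mul0r.
  by apply: eq_bigr => i _; rewrite mulrCA -exprD addnC.
apply: le_trans (hK _ _ _) _; first by apply: le_trans hh; rewrite ler_wpM2r.
rewrite exprD mulrA [in leLHS]exprMn cmodX [leRHS]mulrA [_ ^+ k * (_ + _)]mulrC.
rewrite mulrA; apply: ler_pM => //.
- by rewrite !mulr_ge0// ?exprn_ge0// ltW.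
- by rewrite exprn_ge0// mulr_ge0// ltW.
- by rewrite ler_wpM2r// exprn_ge0.
- by apply: lerXn2r; rewrite ?nnegrE ?mulr_ge0// ?(ltW K0)// ler_wpM2r.
Qed.

Lemma expands_cvg a f z : expands a f z -> {for z, continuous f}.
Proof.
move=> ea; have fz := expands_at ea; case: ea => K K0 hK.
apply/(@cvg_cmod _ _ (nbhs z) (nbhs_filter z) f) => e e0.
have M0 : 0 < Num.min K^-1 (e / (K * K)).
  by rewrite lt_min invr_gt0 K0 divr_gt0// mulr_gt0.
apply/nbhs_cmod; exists (Num.min K^-1 (e / (K * K))) => //.
move=> w; rewrite lt_min => /andP[h1 h2].
have := hK (w - z); rewrite mulrC -ler_pdivlMr// div1r.
move=> /(_ (ltW h1) 1%N); rewrite big_ord1 expr0 mulr1 -fz [z + _]addrC subrK.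
rewrite cmodBC => /le_lt_trans; apply.
by rewrite expr1 mulrCA -ltr_pdivlMr// mulr_gt0.
Qed.

(** [a n * h ^+ n] is the difference of two consecutive remainders, taken at a
    point with [cmod h = K^-1]. *)
Lemma expands_coef_bound a f z : expands a f z ->
  exists2 K : R, 0 < K & [/\ forall n, cmod (a n) <= 2 * K * K ^+ n &
    forall h, K * cmod h <= 1 -> forall N : nat,
    cmod (f (z + h) - \sum_(n < N) a n * h ^+ n) <= K * (K * cmod h) ^+ N].
Proof.
move=> [K K0 hK]; exists K => //; split=> // n.
have Kh : K * cmod (K^-1%:C%C : C R) = 1.
  by rewrite cmod_real ger0_norm ?invr_ge0 ?(ltW K0)// divff// gt_eqF.
set h : C R := K^-1%:C%C in Kh.
have := hK h; rewrite Kh => /(_ (lexx 1)) hh.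
have := lerD (hh n) (hh n.+1); rewrite !expr1n.
move=> /(le_trans (cmodB _ _)).
rewrite (_ : _ - _ - _ = a n * h ^+ n); last by rewrite big_ord_recr /=; ring.
have ch : cmod h = K^-1 by rewrite cmod_real ger0_norm// invr_ge0 ltW.
by rewrite cmodM cmodX ch exprVn mulr1 ler_pdivrMr ?exprn_gt0// => ?; lra.
Qed.

Lemma geometric_sum_le2 (q : R) m : 0 <= q <= 1 / 2 ->
  \sum_(i < m) q ^+ i <= 2.
Proof.
move=> /andP[q0 q1]; elim: m => [|m IH]; first by rewrite big_ord0.
rewrite big_ord_recl expr0 (eq_bigr (fun i : 'I_m => q * q ^+ i)); last first.
  by move=> i _; rewrite exprS.
rewrite -mulr_sumr.
have s0 : 0 <= \sum_(i < m) q ^+ i by rewrite sumr_ge0// => i _; rewrite exprn_ge0.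
have := ler_pM q0 s0 q1 IH; lra.
Qed.

End Expansion.

(** * Analytic functions and termwise differentiation *)

Section Taylor.
Variable R : realType.
Implicit Types (a b : nat -> C R) (f g : C R -> C R) (z w h c : C R).

Lemma geometric_tail (u : nat -> R) (M q : R) (N m : nat) : 0 <= M ->
  0 <= q <= 1 / 2 -> (forall n, u n <= M * q ^+ n) ->
  \sum_(i < m) u (N + i)%N <= 2 * M * q ^+ N.
Proof.
move=> M0 /andP[q0 q1] uM.
apply: (@le_trans _ _ (\sum_(i < m) M * q ^+ N * q ^+ i)).
  by apply: ler_sum => i _; rewrite -mulrA -exprD; exact: uM.
have -> : 2 * M * q ^+ N = M * q ^+ N * 2 by ring.
rewrite -mulr_sumr ler_wpM2l//.
  by rewrite mulr_ge0// exprn_ge0.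
by apply: geometric_sum_le2; rewrite q0 q1.
Qed.

(** Convergence at one point at distance [p] of [z] bounds [cmod (a n) * p ^+ n],
    so that closer to [z] the remainders are dominated by geometric series. *)
Lemma analytic_expands f z : analytic_at f z -> exists a, expands a f z.
Proof.
move=> [a [rho [rho0 ha]]]; exists a.
set p := rho / 2; have p0 : 0 < p by rewrite divr_gt0.
have [M M0 hM] : exists2 M : R, 0 < M & forall n, cmod (a n) * p ^+ n <= M.
  have zp : cmod (z + (p%:C)%C - z) < rho.
    by rewrite addrAC subrr add0r cmod_real ger0_norm ?(ltW p0)// /p; lra.
  have /cvg_cmod/(_ 1 ltr01) := ha _ zp.
  move=> [n0 _ hn0].
  exists (2 + \sum_(i < n0) cmod (a i) * p ^+ i).
    by rewrite ltr_pwDl// sumr_ge0// => i _; rewrite mulr_ge0// exprn_ge0 ?ltW.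
  move=> n; case: (ltnP n n0) => nn0.
    rewrite (bigD1 (Ordinal nn0))//= addrCA lerDl addr_ge0// sumr_ge0//.
    by move=> i _; rewrite mulr_ge0// exprn_ge0 ?ltW.
  rewrite ler_wpDr//.
    by rewrite sumr_ge0// => i _; rewrite mulr_ge0// exprn_ge0 ?ltW.
  have h1 := hn0 n nn0; have h2 := hn0 n.+1 (leqW nn0).
  pose u k := a k * (z + (p%:C)%C - z) ^+ k.
  have := cmodB (f (z + (p%:C)%C) - series u n) (f (z + (p%:C)%C) - series u n.+1).
  rewrite (_ : _ - _ - _ = a n * (p%:C)%C ^+ n); last first.
    by rewrite /series /= big_nat_recr//= /u [z + _ - z]addrAC subrr add0r; ring.
  rewrite cmodM cmodX cmod_real ger0_norm ?(ltW p0)//.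
  by move=> h; apply: (le_trans h); move: h1 h2; rewrite /=; lra.
exists (2 * M + 2 / p); first by rewrite addr_gt0// ?mulr_gt0 ?invr_gt0.
move=> h hh N; have ch := cmod_ge0 h.
have ip0 : 0 < p^-1 by rewrite invr_gt0.
have t1 : 0 <= M * cmod h by rewrite mulr_ge0// ltW.
have hp : 0 <= cmod h / p <= 1 / 2.
  rewrite divr_ge0 ?(ltW p0)//=; move: hh.
  rewrite mulrDl -!mulrA [p^-1 * _]mulrC; lra.
have hrho : cmod (z + h - z) < rho.
  rewrite addrAC subrr add0r; move: hp => /andP[_].
  by rewrite ler_pdivrMr// /p; lra.
have /cvg_cmod cv := ha _ hrho.
apply/ler_addgt0Pr => e /cv[n0 _ hn0].
have := hn0 _ (leq_addl N n0); rewrite /= big_mkord.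
rewrite addrAC subrr add0r big_split_ord /= opprD addrA.
set S := \sum_(i < N) _; set T := \sum_(i < n0) _ => hS.
have hT : cmod T <= 2 * M * (cmod h / p) ^+ N.
  apply: le_trans (cmod_sum _ _ _) _.
  apply: (@geometric_tail (fun n => cmod (a n * h ^+ n))) => //; first exact: ltW.
  move=> n; rewrite cmodM cmodX expr_div_n mulrCA mulrC.
  by rewrite ler_wpM2l ?exprn_ge0// ler_pdivlMr ?exprn_gt0.
have hb : 2 * M * (cmod h / p) ^+ N <= (2 * M + 2 / p) * ((2 * M + 2 / p) * cmod h) ^+ N.
  apply: ler_pM.
  - by rewrite mulr_ge0// ltW.
  - by rewrite exprn_ge0//; case/andP : hp.
  - by rewrite lerDl divr_ge0// ltW.
  - have : 0 <= p^-1 * cmod h by rewrite mulr_ge0// ltW.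
    move=> ?; have -> : (2 * M + 2 / p) * cmod h = 2 * (M * cmod h) + 2 * (p^-1 * cmod h) by ring.
    by apply: lerXn2r; rewrite ?nnegrE; lra.
have := cmodD (f (z + h) - S - T) T; rewrite subrK; lra.
Qed.

(** The remainder of order two, divided by the increment. *)
Lemma derive1_expands a f z : expands a f z -> f^`()%classic z = a 1%N.
Proof.
move=> ea; have fz := expands_at ea; case: ea => K K0 hK.
apply: cvg_lim; first exact: norm_hausdorff.
apply/cvg_cmod => e e0.
have M0 : 0 < Num.min K^-1 (e / K ^+ 3).
  by rewrite lt_min invr_gt0 K0 divr_gt0// exprn_gt0.
rewrite /dnbhs /within /=; apply/nbhs_cmod.
exists (Num.min K^-1 (e / K ^+ 3)) => // h.
rewrite subr0 lt_min => /andP[h1 h2] h0.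
have ch : 0 < cmod h by rewrite cmod_gt0.
have := hK h; rewrite mulrC -ler_pdivlMr// div1r => /(_ (ltW h1) 2%N).
rewrite big_ord_recr big_ord1 /= expr0 mulr1 expr1 -fz => hh.
rewrite cmodBC.
have -> : h^-1 *: (f (h + z) - f z) - a 1%N = h^-1 * (f (z + h) - (f z + a 1%N * h)).
  rewrite [h + z]addrC.
  change (h^-1 * (f (z + h) - f z) - a 1%N
          = h^-1 * (f (z + h) - (f z + a 1%N * h))).
  by field.
rewrite cmodM cmodV mulrC ltr_pdivrMr//; apply: (le_lt_trans hh).
move: h2; rewrite ltr_pdivlMr ?exprn_gt0// => h2.
have -> : K * (cmod h * K) ^+ 2 = cmod h * K ^+ 3 * cmod h by ring.
by rewrite ltr_pM2r.
Qed.

(** The same estimate before division, in the form that is compared with a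
    Taylor polynomial in [expands_derive1]. *)
Lemma expands_increment a f z : expands a f z ->
  forall e : R, 0 < e -> exists2 d : R, 0 < d & forall h, h != 0 -> cmod h < d ->
    cmod (f (z + h) - f z - a 1%N * h) < e * cmod h.
Proof.
move=> ea; have fz := expands_at ea; case: ea => K K0 hK.
move=> e e0.
have M0 : 0 < Num.min K^-1 (e / K ^+ 3).
  by rewrite lt_min invr_gt0 K0 divr_gt0// exprn_gt0.
exists (Num.min K^-1 (e / K ^+ 3)) => // h h0.
rewrite lt_min => /andP[h1 h2].
have ch : 0 < cmod h by rewrite cmod_gt0.
have := hK h; rewrite mulrC -ler_pdivlMr// div1r => /(_ (ltW h1) 2%N).
rewrite big_ord_recr big_ord1 /= expr0 mulr1 expr1 -fz opprD addrA => /le_lt_trans; apply.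
move: h2; rewrite ltr_pdivlMr ?exprn_gt0// => h2.
have -> : K * (cmod h * K) ^+ 2 = cmod h * K ^+ 3 * cmod h by ring.
by rewrite ltr_pM2r.
Qed.

Lemma cmod_subXn (x y : C R) (q : R) n : cmod x <= q -> cmod y <= q ->
  cmod (x ^+ n.+1 - y ^+ n.+1) <= cmod (x - y) * (n.+1%:R * q ^+ n).
Proof.
move=> xq yq; rewrite subrXX cmodM ler_wpM2l//.
apply: le_trans (cmod_sum _ _ _) _.
have -> : n.+1%:R * q ^+ n = \sum_(i < n.+1) q ^+ n.
  by rewrite sumr_const card_ord mulr_natl.
apply: ler_sum => i _; rewrite cmodM !cmodX /=.
have q0 : 0 <= q := le_trans (cmod_ge0 x) xq.
have -> : q ^+ n = q ^+ (n - i) * q ^+ i by rewrite -exprD subnK// -ltnS.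
apply: ler_pM; rewrite ?exprn_ge0//; apply: lerXn2r; rewrite ?nnegrE//.
Qed.

Lemma Xn_subX_bound h n : exists2 A : R, 0 <= A & forall k : C R, cmod k <= 1 ->
  cmod ((h + k) ^+ n.+1 - h ^+ n.+1 - k * (h ^+ n *+ n.+1)) <= A * cmod k ^+ 2.
Proof.
elim: n => [|n [A A0 hA]].
  by exists 0 => // k _; rewrite (_ : _ - _ - _ = 0) ?cmod0 ?mul0r//; ring.
exists ((cmod h + 1) * A + cmod (h ^+ n *+ n.+1)).
  by rewrite addr_ge0// mulr_ge0// addr_ge0.
move=> k k1; set X := h ^+ n *+ n.+1.
have -> : (h + k) ^+ n.+2 - h ^+ n.+2 - k * (h ^+ n.+1 *+ n.+2) =
    (h + k) * ((h + k) ^+ n.+1 - h ^+ n.+1 - k * X) + X * k ^+ 2.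
  rewrite [(h + k) ^+ n.+2]exprS [h ^+ n.+2]exprS mulrS.
  have -> : h ^+ n.+1 *+ n.+1 = h * X by rewrite /X exprS mulrnAr.
  by ring.
apply: le_trans (cmodD _ _) _; rewrite [cmod (X * _)]cmodM cmodX cmodM mulrDl lerD2r.
rewrite -mulrA; apply: ler_pM => //; last exact: hA.
by rewrite (le_trans (cmodD _ _))// lerD2l.
Qed.

(** Only the order of the error matters: the constant depends on [a], [N] and
    [h], and [k] tends to [0] afterwards. *)
Lemma sum_Xn_subX_bound a N h : exists2 A : R, 0 <= A & forall k : C R, cmod k <= 1 ->
  cmod (\sum_(n < N.+1) a n * (h + k) ^+ n - \sum_(n < N.+1) a n * h ^+ n
        - k * \sum_(n < N) a n.+1 *+ n.+1 * h ^+ n) <= A * cmod k ^+ 2.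
Proof.
elim: N => [|N [A A0 hA]].
  by exists 0 => // k _; rewrite !big_ord1 big_ord0 !expr0 mulr0 subrr subr0 cmod0 mul0r.
have [B B0 hB] := Xn_subX_bound h N.
exists (A + cmod (a N.+1) * B); first by rewrite addr_ge0// mulr_ge0.
move=> k k1; rewrite [\sum_(n < N.+2) a n * (h + k) ^+ n]big_ord_recr.
rewrite [\sum_(n < N.+2) a n * h ^+ n]big_ord_recr.
rewrite [\sum_(n < N.+1) a n.+1 *+ n.+1 * _]big_ord_recr /=.
have {hA} := hA k k1; set S1 := \sum_(n < N.+1) a n * (h + k) ^+ n.
set S0 := \sum_(n < N.+1) a n * h ^+ n; set S := \sum_(n < N) _ => hA.
have -> : S1 + a N.+1 * (h + k) ^+ N.+1 - (S0 + a N.+1 * h ^+ N.+1)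
    - k * (S + a N.+1 *+ N.+1 * h ^+ N) = (S1 - S0 - k * S) +
    a N.+1 * ((h + k) ^+ N.+1 - h ^+ N.+1 - k * (h ^+ N *+ N.+1)).
  by rewrite mulrnAl -mulrnAr; ring.
apply: le_trans (cmodD _ _) _; rewrite cmodM mulrDl -mulrA.
by apply: lerD => //; rewrite ler_wpM2l// hB.
Qed.

Lemma exp_half_small (A e : R) : 0 < e -> exists m : nat, A * (1 / 2) ^+ m < e.
Proof.
move=> e0; exists (Num.bound (`|A| / e)).
set m := Num.bound _.
have hm : `|A| / e < m%:R by rewrite archi_boundP// divr_ge0// ltW.
have p0 : 0 < (2 : R) ^+ m by rewrite exprn_gt0.
rewrite div1r exprVn ltr_pdivrMr//.
have h2m : m%:R <= (2 : R) ^+ m by rewrite -natrX ler_nat ltnW// ltn_expl.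
rewrite ltr_pdivrMr// in hm.
apply: (le_lt_trans (ler_norm A)); apply: (lt_le_trans hm).
by rewrite mulrC ler_wpM2l// ltW.
Qed.

(** The Lipschitz constant is that of the termwise derivative of the tail. The
    tail is cut at order [N.+1 + m], with [m] so large that the remainder left
    over is below any given [e]; infinite sums never occur. *)
Lemma expands_tail_lipschitz a f z (K q : R) x y : 0 < K ->
  (forall n, cmod (a n) <= 2 * K * K ^+ n) ->
  (forall h, K * cmod h <= 1 -> forall N : nat,
    cmod (f (z + h) - \sum_(n < N) a n * h ^+ n) <= K * (K * cmod h) ^+ N) ->
  forall N, K * q <= 1 / 4 -> cmod x <= q -> cmod y <= q ->
  cmod ((f (z + y) - \sum_(n < N.+1) a n * y ^+ n)
      - (f (z + x) - \sum_(n < N.+1) a n * x ^+ n))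
    <= cmod (y - x) * (4 * K ^+ 2 * (2 * K * q) ^+ N).
Proof.
move=> K0 aK hK N Kq xq yq.
have q0 : 0 <= q := le_trans (cmod_ge0 x) xq.
have Kq0 : 0 <= K * q by rewrite mulr_ge0// ltW.
apply/ler_addgt0Pr => e e0.
have [|m hm] := @exp_half_small (2 * K) e _; first by [].
have rem w : cmod w <= q ->
    cmod (f (z + w) - \sum_(n < N.+1 + m) a n * w ^+ n) <= K * (1 / 2) ^+ m.
  move=> wq; have Kw : K * cmod w <= 1 / 4.
    by apply: le_trans Kq; rewrite ler_wpM2l// ltW.
  have Kw0 : 0 <= K * cmod w by rewrite mulr_ge0// ltW.
  apply: le_trans (hK _ _ _) _; first by lra.
  rewrite ler_wpM2l ?(ltW K0)// exprD -[leRHS]mul1r.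
  apply: ler_pM; rewrite ?exprn_ge0//.
    by rewrite exprn_ile1//; lra.
  by apply: lerXn2r; rewrite ?nnegrE; lra.
have := rem x xq; have := rem y yq; rewrite !big_split_ord /=.
set Py := \sum_(n < N.+1) a n * y ^+ n; set Px := \sum_(n < N.+1) a n * x ^+ n.
set Ty := \sum_(i < m) _; set Tx := \sum_(i < m) _ => hy hx.
have hT : cmod (Ty - Tx) <= cmod (y - x) * (4 * K ^+ 2 * (2 * K * q) ^+ N).
  rewrite /Ty /Tx -sumrB; apply: le_trans (cmod_sum _ _ _) _.
  have -> : cmod (y - x) * (4 * K ^+ 2 * (2 * K * q) ^+ N)
     = 2 * (2 * K ^+ 2 * cmod (y - x)) * (2 * K * q) ^+ N by ring.
  apply: (@geometric_tail (fun n => cmod (a n.+1 * y ^+ n.+1 - a n.+1 * x ^+ n.+1))).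
  - by rewrite mulr_ge0// mulr_ge0// exprn_ge0// ltW.
  - by rewrite -mulrA; lra.
  - move=> n; rewrite -mulrBr cmodM.
    apply: (@le_trans _ _ (2 * K * K ^+ n.+1 * (cmod (y - x) * (2 ^+ n * q ^+ n)))).
      apply: ler_pM => //; apply: le_trans (cmod_subXn n yq xq) _.
      rewrite ler_wpM2l// ler_wpM2r ?exprn_ge0// -natrX ler_nat.
      exact: ltn_expl.
    by rewrite !exprMn exprS le_eqVlt; apply/orP; left; apply/eqP; ring.
have -> : f (z + y) - Py - (f (z + x) - Px)
   = (Ty - Tx) + ((f (z + y) - (Py + Ty)) - (f (z + x) - (Px + Tx))) by ring.
apply: le_trans (cmodD _ _) _; apply: lerD => //.
by apply: le_trans (cmodB _ _) _; apply: le_trans (lerD hy hx) _; clear -hm; lra.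
Qed.

(** Existence of [f^`()] near [z] comes from the expansions at the neighbouring
    points; the remainders of [f^`()] at [z] are then limits of difference
    quotients of remainders of [f], bounded by [expands_tail_lipschitz]. *)
Lemma expands_derive1 a f z : expands a f z ->
  (\forall w \near z, exists b, expands b f w) ->
  expands (fun n => a n.+1 *+ n.+1) (f^`()%classic) z.
Proof.
move=> ea /nbhs_cmod[d d0 hd].
have [K K0 [aK hK]] := expands_coef_bound ea.
(* [4 K^2] bounds the tail, [8 K] keeps [h] well inside the disc where the
   tail converges, and [2 / d] keeps it where expansions are known *)
set L := 4 * K ^+ 2 + 8 * K + 2 / d.
have id0 : 0 < d^-1 by rewrite invr_gt0.
have K2 : 0 <= K ^+ 2 by rewrite exprn_ge0 ?ltW.
have L0 : 0 < L by rewrite /L; nra.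
exists L => // h hh N.
have ch := cmod_ge0 h.
have t1 : 0 <= K ^+ 2 * cmod h by rewrite mulr_ge0.
have t2 : 0 <= K * cmod h by rewrite mulr_ge0// ltW.
have t3 : 0 <= d^-1 * cmod h by rewrite mulr_ge0// ltW.
have [-> {hh ch t1 t2 t3}|h0] := eqVneq h 0.
  rewrite addr0 (derive1_expands ea); case: N => [|N].
    rewrite big_ord0 subr0 expr0 mulr1 (le_trans (aK _))// expr1 /L.
    nra.
  rewrite big_ord_recl expr0 mulr1 big1 ?addr0 ?subrr ?cmod0.
    by rewrite mulr0 expr0n mulr0.
  by move=> i _; rewrite expr0n mulr0.
have hK8 : 8 * (K * cmod h) <= 1.
  by move: hh; rewrite /L !mulrDl -!mulrA; lra.
have hdd : cmod (z + h - z) < d.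
  have : 2 * (d^-1 * cmod h) <= 1.
    by move: hh; rewrite /L !mulrDl -!mulrA; lra.
  rewrite addrAC subrr add0r => h1.
  have : d * (2 * (d^-1 * cmod h)) <= d * 1 by rewrite ler_wpM2l// ltW.
  have -> : d * (2 * (d^-1 * cmod h)) = 2 * cmod h by field; rewrite gt_eqF.
  by move: h0; rewrite -cmod_gt0; lra.
have [b eb] := hd _ hdd.
rewrite (derive1_expands eb).
apply: (@le_trans _ _ (4 * K ^+ 2 * (4 * K * cmod h) ^+ N)); last first.
  apply: ler_pM.
  - by rewrite mulr_ge0.
  - by rewrite exprn_ge0// mulr_ge0// mulr_ge0// ltW.
  - by rewrite /L; lra.
  - apply: lerXn2r; rewrite ?nnegrE ?(mulr_ge0 (ltW L0))//; first by lra.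
    by rewrite ler_wpM2r// /L; lra.
apply/ler_addgt0Pr => e e0.
have e20 : 0 < e / 4 by rewrite divr_gt0.
have [d1 d10 hd1] := expands_increment eb e20.
have ch0 : 0 < cmod h by rewrite cmod_gt0.
have [C0 C00 hC] := sum_Xn_subX_bound a N h.
(* an increment so small that the quadratic errors are below [e / 4] *)
have [t t0 [th td t1' tC]] : exists2 t : R, 0 < t &
    [/\ t < cmod h, t < d1, t < 1 & t < e / (4 * (C0 + 1))].
  have C1 : 0 < 4 * (C0 + 1) by lra.
  set m := Num.min (Num.min (cmod h) d1) (Num.min 1 (e / (4 * (C0 + 1)))).
  have m0 : 0 < m by rewrite !lt_min ch0 d10 ltr01 divr_gt0.
  exists (m / 2); first by rewrite divr_gt0.
  have : m <= m by []; rewrite {2}/m !le_min.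
  by move=> /andP[/andP[? ?] /andP[? ?]]; split; lra.
set k : C R := (t%:C)%C.
have ck : cmod k = t by rewrite cmod_real ger0_norm// ltW.
have k0 : k != 0 by rewrite -cmod_gt0 ck.
have := hd1 k k0; rewrite ck => /(_ td) h1.
have := hC k; rewrite ck => /(_ (ltW t1')) h2.
(* both [h] and [h + k] lie in the disc of radius [q] *)
set q := 2 * cmod h.
have q0 : 0 <= q by rewrite mulr_ge0.
have hq : cmod h <= q by rewrite /q; lra.
have hkq : cmod (h + k) <= q by rewrite (le_trans (cmodD _ _))// ck /q; lra.
have Kq : K * q <= 1 / 4 by rewrite /q; lra.
have h3 := expands_tail_lipschitz K0 aK hK N Kq hq hkq.
have hk : h + k - h = k by rewrite addrAC subrr add0r.
rewrite hk ck in h3.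
rewrite -(ler_pM2l t0) -{1}ck -cmodM.
rewrite addrA in h3.
set S := \sum_(n < N) _; rewrite -/S in h2.
set F1 := f (z + h + k) in h1 h3; set F0 := f (z + h) in h1 h3.
set P1 := \sum_(n < N.+1) a n * (h + k) ^+ n in h2 h3.
set P0 := \sum_(n < N.+1) a n * h ^+ n in h2 h3.
have -> : k * (b 1%N - S) =
    (F1 - P1 - (F0 - P0)) + (P1 - P0 - k * S) - (F1 - F0 - b 1%N * k) by ring.
apply: le_trans (cmodB _ _) _.
have := cmodD (F1 - P1 - (F0 - P0)) (P1 - P0 - k * S).
have : C0 * t ^+ 2 <= e / 4 * t.
  rewrite expr2 mulrA ler_wpM2r ?(ltW t0)//.
  have C1 : 0 < 4 * (C0 + 1) by lra.
  by move: tC; rewrite ltr_pdivlMr//; nra.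
have -> : 4 * K * cmod h = 2 * K * q by rewrite /q; ring.
have := mulr_gt0 t0 e0; rewrite mulrDr; lra.
Qed.

End Taylor.

(** * The maximum principle for quotients *)

Section MaximumPrinciple.
Variable R : realType.
Implicit Types (a b : nat -> C R) (f g : C R -> C R) (z w h c : C R).

(** At [n = 0] this is [f^(k)(z) = k! a_k]. Differentiating needs expansions on
    a whole neighbourhood, hence the induction over all points of [D]. *)
Lemma derive1n_expands (D : set (C R)) f : open D ->
  (forall z, D z -> exists a, expands a f z) ->
  forall k z a, D z -> expands a f z ->
  expands (fun n => a (n + k)%N *+ (n + k) ^_ k) (f^`(k)%classic) z.
Proof.
move=> oD hf; elim=> [|k IH] z a Dz ea.
  apply: (expands_eq _ _ ea) => [n|]; first by rewrite addn0 ffactn0.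
  by near=> w.
rewrite derive1nS.
apply: (expands_eq _ _ (expands_derive1 (IH z a Dz ea) _)).
- move=> n /=; rewrite -mulrnA addSnnS; congr (_ *+ _).
  by rewrite ffactnSr addnS subSn ?leq_addl// addnK mulnC.
- by near=> w.
- have : \forall w \near z, D w by exact: open_nbhs_nbhs.
  apply: filterS => w Dw; have [b eb] := hf w Dw.
  by eexists; exact: IH eb.
Unshelve. all: by end_near. Qed.

Lemma expands_locally0 a f z : expands a f z -> (forall n, a n = 0) ->
  \forall w \near z, f w = 0.
Proof.
move=> [K K0 hK] a0; apply/nbhs_cmod; exists (K^-1 / 2).
  by rewrite divr_gt0// invr_gt0.
move=> w hw.
have Kw : K * cmod (w - z) <= 1 / 2.
  rewrite mulrC -ler_pdivlMr//; apply/ltW; move: hw; lra.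
have Kw0 : 0 <= K * cmod (w - z) by rewrite mulr_ge0// ltW.
have {}hK N : cmod (f w) <= K * (1 / 2) ^+ N.
  have Kw1 : K * cmod (w - z) <= 1 by lra.
  have := hK (w - z) Kw1 N; rewrite big1; last by move=> i _; rewrite a0 mul0r.
  rewrite subr0 addrCA subrr addr0 => /le_trans; apply.
  by rewrite ler_wpM2l ?(ltW K0)//; apply: lerXn2r; rewrite ?nnegrE; lra.
apply/eqP; rewrite -cmod_eq0 eq_le cmod_ge0 andbT.
apply/ler_addgt0Pr => e e0; have [m hm] := exp_half_small K e0.
by rewrite add0r (le_trans (hK m))// ltW.
Qed.

Lemma root_exists c m : (0 < m)%N -> exists u : C R, u ^+ m = c.
Proof. by move=> m0; exists (@nthroot R[i] m c); exact: (@rootCK R[i]). Qed.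

(** Otherwise [g z * f - f z * g] has a leading term [e m * h ^+ m]; along the
    ray where this term is a positive multiple of [f z * g z], the modulus of
    [f / g] would increase. *)
Lemma quotient_local_max a b f g z : expands a f z -> expands b g z ->
  f z != 0 -> g z != 0 ->
  (\forall w \near z, cmod (f w) * cmod (g z) <= cmod (f z) * cmod (g w)) ->
  \forall w \near z, f w * g z = f z * g w.
Proof.
move=> ea eb f0 g0 /nbhs_cmod[d d0 hmax].
pose D w := g z * f w + (- f z) * g w.
have [e eD] : exists e, expands e D z.
  by eexists; apply: expandsD; [exact: expandsZ ea|exact: expandsZ eb].
suff e_0 : forall n, e n = 0.
  have := expands_locally0 eD e_0; apply: filterS => w.
  by rewrite /D mulNr mulrC => /eqP; rewrite subr_eq0 => /eqP.
move=> n; apply/eqP; apply: contrapT => /negP en.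
have [m em mmin] := ex_minnP (ex_intro (fun n => e n != 0) n en).
have m0 : (0 < m)%N.
  rewrite lt0n; apply/eqP => m0; move: em; rewrite m0 -(expands_at eD) /D.
  by rewrite mulNr mulrC subrr eqxx.
(* [u] is the direction in which the leading term [e m * h ^+ m] is aligned
   with [f z * g z] *)
have [u hu] := root_exists (f z * g z / e m) m0.
have u0 : u != 0.
  apply/eqP => u0; move: hu; rewrite u0 expr0n gtn_eqF//= => /esym/eqP.
  by rewrite !mulf_eq0 invr_eq0 (negbTE f0) (negbTE g0) (negbTE em).
have cu : 0 < cmod u by rewrite cmod_gt0.
have cf : 0 < cmod (f z) by rewrite cmod_gt0.
have cg : 0 < cmod (g z) by rewrite cmod_gt0.
have gz := expands_at eb.
case: eD => K K0 hK; case: eb => L L0 hL.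
(* constants of the error terms along the ray [t u] *)
set E1 := K * (K * cmod u) ^+ m.+1; set E2 := L * (L * cmod u).
have E10 : 0 <= E1 by rewrite mulr_ge0 ?exprn_ge0// ?mulr_ge0// ltW.
have E20 : 0 <= E2 by rewrite !mulr_ge0// ltW.
set T := cmod (f z) * E2 * 2 + E1 + 1.
have T0 : 0 < T by rewrite /T; have := mulr_ge0 (ltW cf) E20; lra.
have Ku0 : 0 < K * cmod u by rewrite mulr_gt0.
have Lu0 : 0 < L * cmod u by rewrite mulr_gt0.
have [t t0 [t1 tK tL td tT]] : exists2 t : R, 0 < t &
    [/\ t < 1, t < (K * cmod u)^-1, t < (L * cmod u)^-1, t < d / cmod u &
        t < cmod (f z) * cmod (g z) / T].
  set v := Num.min (Num.min 1 (K * cmod u)^-1) (Num.min (L * cmod u)^-1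
     (Num.min (d / cmod u) (cmod (f z) * cmod (g z) / T))).
  have v0 : 0 < v.
    by rewrite !lt_min ltr01 !invr_gt0 Ku0 Lu0 !divr_gt0// mulr_gt0.
  exists (v / 2); first by rewrite divr_gt0.
  have : v <= v by []; rewrite {2}/v !le_min.
  by move=> /andP[/andP[? ?] /andP[? /andP[? ?]]]; split; lra.
set h : C R := (t%:C)%C * u.
have ch : cmod h = t * cmod u by rewrite cmodM cmod_real ger0_norm// ltW.
have hh : cmod (z + h - z) < d.
  by rewrite addrAC subrr add0r ch -ltr_pdivlMr.
have := hmax _ hh.
have Kh : K * cmod h <= 1.
  rewrite ch mulrCA; apply/ltW; rewrite -ltr_pdivlMr// div1r//.
have Lh : L * cmod h <= 1.
  rewrite ch mulrCA; apply/ltW; rewrite -ltr_pdivlMr// div1r//.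
have := hK h Kh m.+1; rewrite big_ord_recr /= big1 ?add0r; last first.
  move=> i _; case: (eqVneq (e i) 0) => [->|ei]; first by rewrite mul0r.
  by have := mmin _ ei; rewrite leqNgt ltn_ord.
have := hL h Lh 1%N; rewrite big_ord1 expr0 mulr1 -gz expr1.
set F1 := f (z + h); set G1 := g (z + h); set F0 := f z; set G0 := g z.
have -> : e m * h ^+ m = ((t ^+ m)%:C)%C * (F0 * G0).
  rewrite exprMn hu mulrCA -rmorphXn; congr (_ * _).
  by rewrite mulrCA divff// mulr1.
set s := t ^+ m; have s0 : 0 < s by rewrite exprn_gt0.
have s1 : s <= 1 by rewrite exprn_ile1// ltW.
rewrite ch => h1 h2 h3.
have h2' : cmod (D (z + h) - (s%:C)%C * (F0 * G0)) <= E1 * (s * t).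
  apply: le_trans h2 _; rewrite /E1 mulrCA exprMn /s -exprSr.
  by rewrite le_eqVlt; apply/orP; left; apply/eqP; ring.
have h1' : cmod (G1 - G0) <= E2 * t.
  by apply: le_trans h1 _; rewrite /E2 le_eqVlt; apply/orP; left; apply/eqP; ring.
clear h1 h2.
(* [F1 G0 = (1 + s) F0 G1] up to an error of order [s t], while [s] is the
   gain of the leading term *)
have key : (1 + s) * (cmod F0 * cmod G1) <=
    cmod F1 * cmod G0 + s * (cmod F0 * (E2 * t)) + E1 * (s * t).
  have -> : (1 + s) * (cmod F0 * cmod G1) = cmod (((1 + s)%:C)%C * (F0 * G1)).
    by rewrite !cmodM cmod_real ger0_norm//; lra.
  have -> : ((1 + s)%:C)%C * (F0 * G1) = F1 * G0 +
      (s%:C)%C * (F0 * (G1 - G0)) - (D (z + h) - (s%:C)%C * (F0 * G0)).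
    by rewrite /D -/F1 -/G1 -/F0 -/G0 rmorphD rmorph1; ring.
  apply: le_trans (cmodB _ _) _; apply: lerD => //.
  apply: le_trans (cmodD _ _) _; rewrite !cmodM cmod_real ger0_norm ?(ltW s0)//.
  by rewrite lerD2l ler_wpM2l ?(ltW s0)// ler_wpM2l.
have {}key : s * (cmod F0 * cmod G1) <= s * (cmod F0 * (E2 * t) + E1 * t) by lra.
rewrite ler_pM2l// in key.
have gg : cmod G0 <= cmod G1 + E2 * t.
  have := cmodB G1 (G1 - G0); rewrite opprB addrCA subrr addr0; lra.
have : cmod F0 * cmod G0 <= cmod F0 * (cmod G1 + E2 * t) by rewrite ler_wpM2l.
move: tT; rewrite ltr_pdivlMr// /T.
have : 0 <= t * (cmod F0 * E2) by rewrite mulr_ge0 ?mulr_ge0// ltW.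
by rewrite -/F0 -/G0; lra.
Qed.

Lemma cmod_continuous : continuous (@cmod R).
Proof.
move=> z; apply/(@cvgrPdist_lt _ _ _ (nbhs z) (nbhs_filter z)) => e e0.
apply/nbhs_cmod; exists e => // w hw.
have := cmodB_ge z w; have := cmodB_ge w z; rewrite [cmod (z - w)]cmodBC.
by rewrite ltr_norml; lra.
Qed.

(** Real coordinates carry compactness over to the complex disc. *)
Lemma compact_cdisc (r : R) : compact [set z : C R | cmod z <= r].
Proof.
pose i (p : R * R) : C R := (p.1 +i* p.2)%C.
have ci : continuous i.
  move=> p; apply/(@cvg_cmod _ _ (nbhs p) (nbhs_filter p) i) => e e0.
  have e20 : 0 < e / 2 by rewrite divr_gt0.
  near=> q.
  have -> : i p - i q = (((p.1 - q.1)%:C)%C : C R) + ((0 +i* 1)%C : C R) * ((p.2 - q.2)%:C)%C.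
    by rewrite /i; simpc.
  apply: le_lt_trans (cmodD _ _) _.
  rewrite cmodM !cmod_real.
  have -> : cmod ((0 +i* 1)%C : C R) = 1.
    by rewrite /cmod /= expr0n expr1n add0r sqrtr1.
  rewrite mul1r [ltRHS](splitr e) ltrD//.
    near: q; apply: (@cvgr_dist_lt _ _ _ (nbhs p) _ fst) => //; exact: cvg_fst.
  near: q; apply: (@cvgr_dist_lt _ _ _ (nbhs p) _ snd) => //; exact: cvg_snd.
have -> : [set z : C R | cmod z <= r] =
    i @` ([set p | cmod (i p) <= r] `&` (`[- r, r] `*` `[- r, r])).
  apply/seteqP; split=> [[x y] /= h|_ [p [hp _] <-]//].
  exists (x, y) => //; split=> //; rewrite /= !in_itv /=.
  have n0 : 0 <= x ^+ 2 + y ^+ 2 by rewrite addr_ge0// sqr_ge0.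
  have r0 : 0 <= r := le_trans (sqrtr_ge0 _) h.
  have h2 : x ^+ 2 + y ^+ 2 <= r ^+ 2.
    by rewrite -(sqr_sqrtr n0) lerXn2r ?nnegrE ?sqrtr_ge0.
  by split; rewrite -ler_norml -(ler_pXn2r (n := 2))// ?nnegrE// real_normK ?num_real//;
    have := sqr_ge0 x; have := sqr_ge0 y; lra.
apply: continuous_compact; first exact: continuous_subspaceT.
rewrite setIC; apply: compact_closedI.
  by apply: compact_setX; exact: segment_compact.
have -> : [set p | cmod (i p) <= r] = (@cmod R \o i) @^-1` [set x : R | x <= r] by [].
apply: closed_comp; last exact: closed_le.
by move=> p _; apply: continuous_comp; [exact: ci|exact: cmod_continuous].
Unshelve. all: by end_near. Qed.

(** [N] is locally the modulus of a meromorphic function without pole. The pair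
    [f], [g] depends on the point, because a removable singularity asks for
    other representatives at that point. *)
Definition quotient_modulus (N : C R -> R) z := exists a b f g,
  [/\ expands a f z, expands b g z, g z != 0 &
      \forall w \near z, N w * cmod (g w) = cmod (f w)].

Lemma expands_neq0 b g z : expands b g z -> g z != 0 ->
  \forall w \near z, g w != 0.
Proof.
move=> eb g0; have cg := expands_cvg eb.
have p0 : 0 < cmod (g z) by rewrite cmod_gt0.
have /(@cvg_cmod _ _ (nbhs z) (nbhs_filter z) g)/(_ _ p0) := cg.
apply: filterS => w hw; apply/eqP => gw; move: hw.
by rewrite gw subr0 ltxx.
Qed.

Lemma quotient_modulus_ge0 N z : quotient_modulus N z -> 0 <= N z.
Proof.
move=> [a [b [f [g [_ _ g0 /nbhs_singleton h]]]]].
have := cmod_ge0 (f z); rewrite -h pmulr_lge0// cmod_gt0//.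
Qed.

Lemma quotient_modulus_cvg N z : quotient_modulus N z -> {for z, continuous N}.
Proof.
move=> [a [b [f [g [ea eb g0 h]]]]].
have gn := expands_neq0 eb g0.
have hN : \forall w \near z, cmod (f w) / cmod (g w) = N w.
  by near=> w; rewrite -(near h w)// mulfK// cmod_eq0; near: w.
have Nz := nbhs_singleton hN.
rewrite /prop_for /continuous_at -Nz; apply: cvg_trans; first exact: (near_eq_cvg hN).
apply: cvgM.
  by apply: continuous_comp; [exact: expands_cvg ea | exact: cmod_continuous].
apply: cvgV; first by rewrite cmod_eq0.
by apply: continuous_comp; [exact: expands_cvg eb | exact: cmod_continuous].
Unshelve. all: by end_near. Qed.

(** Moving away from the origin, also from the origin itself. *)
Lemma cmod_outward z (t : R) : 0 <= t ->
  exists2 w : C R, cmod w = cmod z + t & cmod (w - z) = t.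
Proof.
move=> t0; case: (eqVneq z 0) => [->|z0].
  by exists ((t%:C)%C : C R); rewrite ?subr0 cmod_real ger0_norm// cmod0 add0r.
have cz : 0 < cmod z by rewrite cmod_gt0.
exists (((1 + t / cmod z)%:C)%C * z).
  rewrite cmodM cmod_real ger0_norm ?addr_ge0// ?divr_ge0//.
  by rewrite mulrDl mul1r divfK// gt_eqF.
rewrite rmorphD rmorph1 mulrDl mul1r addrAC subrr add0r cmodM cmod_real.
by rewrite ger0_norm ?divr_ge0// divfK// gt_eqF.
Qed.

(** Among the maximum points of [N] choose one farthest from the origin. If it
    were interior, [N] would be constant around it, and moving outward would give
    a maximum point farther away. *)
Lemma quotient_maximum_principle N (r : R) : 0 < r ->
  (forall z, cmod z <= r -> quotient_modulus N z) ->
  exists2 w, cmod w = r & N 0 <= N w.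
Proof.
move=> r0 hN; set K := [set z : C R | cmod z <= r].
have [w0 w0r _] := cmod_outward 0 (ltW r0); rewrite cmod0 add0r in w0r.
have cK : compact K := @compact_cdisc r.
have K0 : K 0 by rewrite /K /mkset cmod0 ltW.
have ctN (A : set (C R)) : A `<=` K -> {within A, continuous N}.
  move=> AK; apply: continuous_in_subspaceT => z /set_mem/AK Kz.
  exact: quotient_modulus_cvg (hN z Kz).
have [c /set_mem Kc maxc] := compact_EVT_max (ex_intro _ 0 K0) cK (ctN K (@subset_refl _ K)).
(* the set of maximum points of [N] on the disc *)
pose A := K `&` [set z | N c <= N z].
have clA : closed A.
  move=> z clz.
  have Kz : K z.
    have clK : closed K by apply: compact_closed => //; exact: norm_hausdorff.
    by apply: clK => B Bz; have [y [[Ky _] By]] := clz B Bz; exists y.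
  split=> //=; rewrite leNgt; apply/negP => Nzc.
  have hlt : \forall w \near z, N w < N c.
    apply: (@cvgr_lt _ _ (nbhs z) (nbhs_filter z) N (N z)) => //.
    exact: quotient_modulus_cvg (hN z Kz).
  by have [y [[_ /= hy1] /=]] := clz _ hlt; rewrite ltNge hy1.
have cA : compact A by apply: subclosed_compact clA cK _; exact: subIsetl.
have A0 : A !=set0 by exists c; split => //=.
have [m /set_mem[Km /= Nm] maxm] := compact_EVT_max A0 cA
   (@continuous_subspaceT _ _ A (@cmod R) cmod_continuous).
have hmax z : K z -> N z <= N m.
  by move=> Kz; apply: le_trans Nm; apply: maxc; exact/mem_set.
have [mr|mr] := eqVneq (cmod m) r.
  by exists m => //; exact: hmax.
have {}mr : cmod m < r by rewrite lt_neqAle mr.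
have [a [b [f [g [ea eb g0 hq]]]]] := hN m Km.
have hqm := nbhs_singleton hq.
have cg : 0 < cmod (g m) by rewrite cmod_gt0.
(* if the maximum is [0], any boundary point will do *)
have [f0|f0] := eqVneq (f m) 0.
  exists w0 => //; have Nm0 : N m = 0.
    by apply/eqP; move/eqP : hqm; rewrite f0 cmod0 mulf_eq0 (gt_eqF cg) orbF.
  have := hmax 0 K0; rewrite Nm0 => /le_trans; apply.
  by apply: quotient_modulus_ge0; apply: hN; rewrite w0r.
have nearK : \forall w \near m, K w.
  apply/nbhs_cmod; exists (r - cmod m); first by rewrite subr_gt0.
  move=> w hw; rewrite /K /=; have := cmodD (w - m) m; rewrite subrK; lra.
have loc : \forall w \near m, N w = N m.
  have lm : \forall w \near m, cmod (f w) * cmod (g m) <= cmod (f m) * cmod (g w).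
    near=> w.
    rewrite -(near hq w)// -hqm mulrAC ler_wpM2r// ler_wpM2r//; apply: hmax.
    by near: w.
  have := quotient_local_max ea eb f0 g0 lm.
  move=> hloc; have gn := expands_neq0 eb g0; near=> w.
  have gw : cmod (g w) != 0 by rewrite cmod_eq0; near: w.
  apply: (mulIf gw); apply: (mulIf (lt0r_neq0 cg)).
  by rewrite (near hq w)// mulrAC hqm -!cmodM (near hloc w).
have [d d0 hd] := (iffLR (nbhs_cmod _ _) (filterI loc nearK)).
have d20 : 0 < d / 2 by rewrite divr_gt0.
have [w wm wd] := cmod_outward m (ltW d20).
have [|Nw Kw] := hd w; first by rewrite wd; lra.
have Aw : A w by split=> //=; rewrite Nw.
by have := maxm w (mem_set Aw); rewrite wm; lra.
Unshelve. all: by end_near. Qed.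

End MaximumPrinciple.

(** * Wiener's bound on Taylor coefficients *)

Section Coefficients.
Variable R : realType.
Implicit Types (a b : nat -> C R) (f g : C R -> C R) (z w h c : C R).

(** The squares of the two sides differ by [(1 - |c|^2) (1 - |w|^2)]. *)
Lemma cmod_sub_le_disc_automorphism (c w : C R) : cmod c <= 1 -> cmod w <= 1 ->
  cmod (w - c) <= cmod (1 - (c : R[i])^*%C * w).
Proof.
case: c w => [a b] [x y]; rewrite /cmod /= => hc hw.
have sq (u v : R) : Num.sqrt (u ^+ 2 + v ^+ 2) <= 1 -> u ^+ 2 + v ^+ 2 <= 1.
  have n0 : 0 <= u ^+ 2 + v ^+ 2 by rewrite addr_ge0// sqr_ge0.
  move=> h; rewrite -(sqr_sqrtr n0) -[leRHS](expr1n _ 2).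
  by rewrite lerXn2r ?nnegrE ?sqrtr_ge0.
have {}hc := sq _ _ hc; have {}hw := sq _ _ hw.
rewrite ler_wsqrtr//.
have : 0 <= (1 - (a ^+ 2 + b ^+ 2)) * (1 - (x ^+ 2 + y ^+ 2)).
  by rewrite mulr_ge0// subr_ge0.
lra.
Qed.

Lemma conjc_mulr (c : C R) : (c : R[i])^*%C * c = ((cmod c ^+ 2)%:C)%C :> R[i].
Proof. case: c => a b; rewrite /cmod /= sqr_sqrtr ?addr_ge0 ?sqr_ge0//.
by apply/eqP; simpc; rewrite eq_complex /= ; apply/andP; split; apply/eqP; ring. Qed.

Lemma cmod_conj (c : C R) : cmod ((c : R[i])^*%C : C R) = cmod c.
Proof. by case: c => a b; rewrite /cmod /= sqrrN. Qed.

(** The Schwarz lemma for a zero of order [k], after composition with the disc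
    automorphism that sends [b 0] to [0]. *)
Lemma schwarz_lemma_order f b (k : nat) (s rho : R) : (0 < k)%N ->
  (forall z, cmod z < s -> exists a, expands a f z) ->
  (forall z, cmod z < s -> cmod (f z) <= 1) ->
  expands b f 0 -> cmod (b 0%N) < 1 ->
  (forall n, (0 < n < k)%N -> b n = 0) ->
  0 < rho < s -> cmod (b k) * rho ^+ k <= 1 - cmod (b 0%N) ^+ 2.
Proof.
move=> k0 fa f1 eb b1 bk /andP[r0 rs].
set c := b 0%N; set c' : C R := (c : R[i])^*%C.
have c2 : 0 < 1 - cmod c ^+ 2 by rewrite subr_gt0 exprn_ilt1// -lt0n.
pose F w := f w - c; pose G w := 1 - c' * f w.
have F_exp z a : expands a f z -> expands (fun n => a n + (if n is 0 then - c else 0)) F z.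
  by move=> ea; apply: expandsD ea (expands_cst (- c) z).
have G_exp z a : expands a f z -> exists e, expands e G z.
  move=> ea; have h := expandsD (expands_cst 1 z) (expandsZ (- c') ea).
  eexists; apply: (expands_eq _ _ h) => //; near=> w; rewrite /G mulNr //.
have G0 z : cmod z < s -> G z != 0.
  move=> zs; rewrite -cmod_gt0 /G; apply: lt_le_trans (cmodB_ge _ _).
  rewrite cmod1 cmodM cmod_conj subr_gt0.
  apply: le_lt_trans b1; rewrite -[leRHS]mulr1 ler_wpM2l//; exact: f1.
pose N w := if w == 0 then cmod (b k) / (1 - cmod c ^+ 2) else
  cmod (F w) / (cmod w ^+ k * cmod (G w)).
have hN z : cmod z <= rho -> quotient_modulus N z.
  move=> zr; have zs := le_lt_trans zr rs.
  have [a ea] := fa z zs; have [-> {zr zs a ea z}|z0] := eqVneq z 0.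
    have [e eG] := G_exp _ _ eb.
    have eF := F_exp _ _ eb.
    have Fk n : (n < k)%N -> b n + (if n is 0 then - c else 0) = 0.
      case: n => [|n] nk; first by rewrite subrr.
      by rewrite addr0 bk.
    have s0 : cmod (0 : C R) < s by rewrite cmod0 (lt_trans r0).
    have eQ := expands_divXn eF Fk.
    eexists; exists e; eexists; exists G; split; [exact: eQ|exact: eG|exact: G0|].
    have f0 := expands_at eb.
    apply/nbhs_cmod; exists s; first exact: lt_trans rs.
    move=> w; rewrite subr0 => ws; rewrite /N; case: eqVneq => [->|w0].
      have -> : cmod (G 0) = 1 - cmod c ^+ 2.
        rewrite /G f0 -/c /c' -[X in 1 - X]/(_ * _ : R[i]) conjc_mulr.
        by rewrite -[1 : C R]/((1%:C)%C : R[i]) -rmorphB cmod_real ger0_norm// ltW.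
      rewrite divfK ?gt_eqF//; congr cmod.
      by case: (k) k0 => // n _; rewrite addr0.
    rewrite cmodM cmodV cmodX; field.
    by rewrite expf_neq0 ?cmod_eq0 ?G0.
  have [e eG] := G_exp _ _ ea.
  have eF := F_exp _ _ ea.
  have [e' eG'] := expands_mulXn eG k.
  eexists; exists e', F; eexists; split; [exact: eF|exact: eG'| |].
    by rewrite mulf_neq0 ?expf_neq0 ?G0.
  have z0' : 0 < cmod z by rewrite cmod_gt0.
  apply/nbhs_cmod; exists (Num.min (cmod z) (s - cmod z)).
    by rewrite lt_min z0' subr_gt0.
  move=> w; rewrite lt_min => /andP[wz ws].
  have w0 : w != 0.
    by apply/eqP => w0; move: wz; rewrite w0 sub0r cmodN ltxx.
  have {}ws : cmod w < s by have := cmodD (w - z) z; rewrite subrK; lra.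
  rewrite /N (negbTE w0) cmodM cmodX divfK// mulf_neq0 ?expf_neq0//.
    by rewrite cmod_eq0.
  by rewrite cmod_eq0 G0.
have [w wr] := quotient_maximum_principle r0 hN.
rewrite /N eqxx ifF; last by rewrite -cmod_eq0 wr gt_eqF.
have ws : cmod w < s by rewrite wr.
have gw : 0 < cmod (G w) by rewrite cmod_gt0 G0.
have rk : 0 < rho ^+ k by rewrite exprn_gt0.
rewrite wr ler_pdivrMr// mulrAC ler_pdivlMr ?mulr_gt0// mulrA.
have := cmod_sub_le_disc_automorphism (ltW b1) (f1 w ws).
rewrite -/c -/c' -/(G w) -/(F w) => FG.
have := ler_wpM2r (ltW c2) FG; move=> h1 h2.
have := le_trans h2 h1; rewrite [cmod (G w) * _]mulrC ler_pM2r//.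
Unshelve. all: by end_near. Qed.

Lemma prim_root_exists n : (0 < n)%N -> exists x : C R, n.-primitive_root x.
Proof.
move=> n0; pose p : {poly R[i]} := 'X^n - 1.
have [r Dp] := closed_field_poly_normal p.
rewrite (monicP _) ?monicXnsubC // scale1r in Dp.
have rn1 : all n.-unity_root r by apply/allP=> z; rewrite -root_prod_XsubC -Dp.
have sz_r : (n < (size r).+1)%N.
  by rewrite -(size_prod_XsubC r id) -Dp size_XnsubC.
have [|z] := hasP (has_prim_root n0 rn1 _ sz_r); last by exists z.
by rewrite -separable_prod_XsubC -Dp separable_Xn_sub_1// pnatr_eq0 -lt0n.
Qed.

Lemma prim_root_sum (F : fieldType) (x : F) k n : k.-primitive_root x -> ~~ (k %| n)%N ->
  \sum_(j < k) (x ^+ j) ^+ n = 0.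
Proof.
move=> px kn; have x1 : x ^+ n != 1 by rewrite -(prim_order_dvd px).
apply: (mulfI (_ : x ^+ n - 1 != 0)); first by rewrite subr_eq0.
rewrite mulr0 (eq_bigr (fun j : 'I_k => (x ^+ n) ^+ j)); last first.
  by move=> j _; rewrite exprAC.
by rewrite -subrX1 exprAC (prim_expr_order px) expr1n subrr.
Qed.

(** Wiener's trick: averaging over rotations by [k]-th roots of unity makes the
    coefficients of index strictly between [0] and [k] vanish and leaves those of
    index [0] and [k] unchanged. *)
Lemma coefficient_bound f a z (k : nat) (s rho : R) : (0 < k)%N ->
  (forall w, cmod (w - z) < s -> exists b, expands b f w) ->
  (forall w, cmod (w - z) < s -> cmod (f w) < 1) ->
  expands a f z -> 0 < rho < s ->
  cmod (a k) * rho ^+ k <= 1 - cmod (f z) ^+ 2.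
Proof.
move=> k0 fa f1 ea rs; have s0 : 0 < s by case/andP: rs; exact: lt_trans.
have [x px] := prim_root_exists k0.
have x1 : cmod x = 1.
  apply/eqP; rewrite -(@pexpr_eq1 _ _ k)//; apply/eqP.
  by rewrite -cmodX (prim_expr_order px) cmod1.
have xj j w : cmod (z + x ^+ j * w - z) = cmod w.
  by rewrite addrAC subrr add0r cmodM cmodX x1 expr1n mul1r.
have kC : cmod ((k%:R)^-1 : C R) = k%:R^-1 by rewrite cmodV cmod_nat.
pose G w := (k%:R)^-1 * \sum_(j < k) f (z + x ^+ j * w).
have G_exp (w : C R) (b : 'I_k -> nat -> C R) :
    (forall j, expands (b j) f (z + x ^+ j * w)) ->
    expands (fun n => k%:R^-1 * \sum_(j < k) b j n * (x ^+ j) ^+ n) G w.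
  move=> h; apply: expandsZ.
  by apply: (@expands_sum _ _ _ (fun j n => b j n * (x ^+ j) ^+ n)
    (fun j w => f (z + x ^+ j * w))) => j; exact: expands_dilate.
have ea0 (j : 'I_k) : expands a f (z + x ^+ j * 0) by rewrite mulr0 addr0.
have eG := G_exp 0 (fun=> a) ea0.
have kn0 : (k%:R : C R) != 0 by rewrite pnatr_eq0 -lt0n.
have b0 : k%:R^-1 * \sum_(j < k) a 0%N * (x ^+ j) ^+ 0 = f z.
  rewrite (eq_bigr (fun=> a 0%N)); last by move=> j _; rewrite expr0 mulr1.
  by rewrite sumr_const card_ord -[a 0%N *+ k]mulr_natl mulrA mulVf// mul1r (expands_at ea).
have bk : k%:R^-1 * \sum_(j < k) a k * (x ^+ j) ^+ k = a k.
  rewrite (eq_bigr (fun=> a k)); last first.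
    by move=> j _; rewrite exprAC (prim_expr_order px) expr1n mulr1.
  by rewrite sumr_const card_ord -[a k *+ k]mulr_natl mulrA mulVf// mul1r.
have := schwarz_lemma_order k0 _ _ eG _ _ rs; rewrite b0 bk; apply.
- move=> w ws.
  have hb (j : 'I_k) : exists b, expands b f (z + x ^+ j * w) by apply: fa; rewrite xj.
  have [b hb'] := choice hb.
  by eexists; exact: G_exp hb'.
- move=> w ws; rewrite /G cmodM kC mulrC ler_pdivrMr ?ltr0n// mul1r.
  apply: le_trans (cmod_sum _ _ _) _.
  have -> : k%:R = \sum_(j < k) (1 : R) by rewrite sumr_const card_ord.
  by apply: ler_sum => j _; apply/ltW/f1; rewrite xj.
- by apply: f1; rewrite subrr cmod0.
- move=> n /andP[n0 nk]; rewrite -mulr_sumr prim_root_sum ?mulr0//.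
  by rewrite gtnNdvd.
Qed.

End Coefficients.

(** * The Bohr-type inequality *)

Section Assembly.
Variable R : realType.
Implicit Types (f : C R -> C R) (z w : C R).

Lemma exprn_bound_limit (A B s : R) k : 0 < s ->
  (forall rho, 0 < rho < s -> A * rho ^+ k <= B) -> A * s ^+ k <= B.
Proof.
move=> s0 h; rewrite leNgt; apply/negP => BA.
have cf : (fun x : R => A * x ^+ k) x @[x --> s] --> A * s ^+ k.
  by apply: cvgM; [exact: cvg_cst | exact: exprn_continuous].
have : \forall x \near s^'-, B < A * x ^+ k.
  exact: cvgr_gt (cvg_at_left_filter cf) _ BA.
move=> near_s.
have : \forall x \near s^'-, A * x ^+ k <= B.
  near=> x; apply: h; apply/andP; split; last by near: x; exact: nbhs_left_lt.
  by near: x; exact: nbhs_left_gt.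
move=> near_s'.
have [x [h1 h2]] := @filter_ex _ _ _ _ (filterI near_s near_s').
by move: h1; rewrite ltNge h2.
Unshelve. all: by end_near. Qed.

Lemma geometric_sum_from1 (q : R) n : 0 <= q < 1 ->
  \sum_(1 <= k < n) q ^+ k <= q / (1 - q).
Proof.
move=> /andP[q0 q1]; have p : 0 < 1 - q by rewrite subr_gt0.
case: n => [|n]; first by rewrite big_geq// divr_ge0// ltW.
suff -> : \sum_(1 <= k < n.+1) q ^+ k = (q - q ^+ n.+1) / (1 - q).
  by rewrite ler_pM2r ?invr_gt0// lerBlDr lerDl exprn_ge0.
elim: n => [|n IH]; first by rewrite big_geq// expr1 subrr mul0r.
by rewrite big_nat_recr//= IH [q ^+ n.+2]exprS; field; rewrite gt_eqF.
Qed.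

Lemma taylor_bound f z k : BA f -> unit_disc z -> (0 < k)%N ->
  cmod (f^`(k)%classic z / k`!%:R) * (1 - cmod z) ^+ k <= 1 - cmod (f z) ^+ 2.
Proof.
move=> [fa f1] zD k0.
have oD : open (@unit_disc R).
  rewrite openE => w wD; apply/nbhs_cmod; exists (1 - cmod w).
    by rewrite subr_gt0.
  by move=> v vw; rewrite /unit_disc /=; have := cmodD (v - w) w; rewrite subrK; lra.
have fe w : unit_disc w -> exists a, expands a f w.
  by move=> wD; apply: analytic_expands; exact: fa.
have [a ea] := fe z zD.
have := expands_at (derive1n_expands oD fe k zD ea).
rewrite add0n ffactnn => ->.
have kf : (k`!%:R : C R) != 0 by rewrite pnatr_eq0 -lt0n fact_gt0.
rewrite -[a k *+ _]mulr_natr mulfK//.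
apply: exprn_bound_limit; first by rewrite subr_gt0.
move=> rho hrho; apply: (coefficient_bound k0 _ _ ea hrho) => w hw.
  by apply: fe; rewrite /unit_disc /=; have := cmodD (w - z) z; rewrite subrK; lra.
by apply: f1; rewrite /unit_disc /=; have := cmodD (w - z) z; rewrite subrK; lra.
Qed.

Lemma taylor_sum_bound f z : BA f -> unit_disc z -> cmod z < 1 / 2 ->
  (\sum_(1 <= k <oo) (cmod (f^`(k)%classic z / k`!%:R) * cmod z ^+ k)%:E <=
   ((1 - cmod (f z) ^+ 2) * (cmod z / (1 - 2 * cmod z)))%:E)%E.
Proof.
move=> hf zD z2; set r := cmod z; have r0 : 0 <= r by exact: cmod_ge0.
apply: lime_le.
  apply: is_cvg_nneseries => n _ _.
  by rewrite lee_fin mulr_ge0// exprn_ge0.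
near=> n; rewrite sumEFin lee_fin.
set q := r / (1 - r); have r1 : 0 < 1 - r by rewrite /r; lra.
have q1 : 0 <= q < 1.
  by rewrite divr_ge0 ?(ltW r1)//= ltr_pdivrMr// mul1r /r; lra.
have -> : r / (1 - 2 * r) = q / (1 - q).
  by rewrite /q; field; apply/andP; split; apply/eqP; rewrite /r; lra.
have B0 : 0 <= 1 - cmod (f z) ^+ 2.
  by rewrite subr_ge0 exprn_ile1//; apply: ltW; case: hf => _; exact.
apply: (@le_trans _ _ (\sum_(1 <= k < n) (1 - cmod (f z) ^+ 2) * q ^+ k)); last first.
  by rewrite -mulr_sumr ler_wpM2l// geometric_sum_from1.
rewrite big_nat_cond [leRHS]big_nat_cond.
apply: ler_sum => k /andP[/andP[k1 _] _].
rewrite expr_div_n mulrA ler_pdivlMr ?exprn_gt0//.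
rewrite mulrAC; apply: ler_wpM2r; first by rewrite exprn_ge0.
exact: taylor_bound.
Unshelve. all: by end_near. Qed.

(** The discriminant is [(2 alpha - beta - 1)^2 + 4 beta], so its square root
    exceeds [2 alpha - beta - 1]. *)
Lemma R4_lt_half (alpha beta : R) : 0 < beta -> R4 alpha beta < 1 / 2.
Proof.
move=> b0; rewrite /R4; set D := _ - 8 * _; set S := Num.sqrt D.
have D0 : 0 <= D.
  have -> : D = (2 * alpha - beta - 1) ^+ 2 + 4 * beta by rewrite /D; ring.
  by rewrite addr_ge0 ?sqr_ge0// mulr_ge0// ltW.
have S0 : 0 <= S by exact: sqrtr_ge0.
have SD : S ^+ 2 = D by exact: sqr_sqrtr.
suff : 2 * alpha - beta - 1 < S by lra.
rewrite ltNge; apply/negP => h.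
have : S ^+ 2 <= (2 * alpha - beta - 1) ^+ 2 by apply: lerXn2r; rewrite ?nnegrE//; lra.
by rewrite SD /D; lra.
Qed.

(** The difference of the two sides is the quadratic polynomial whose smaller
    root is [R4]. *)
Lemma le_R4 (alpha beta r : R) : 0 < beta -> r <= R4 alpha beta ->
  beta * (1 - r) <= (alpha - r) * (1 - 2 * r).
Proof.
move=> b0; rewrite /R4; set D := _ - 8 * _; set S := Num.sqrt D => hr.
have D0 : 0 <= D.
  have -> : D = (2 * alpha - beta - 1) ^+ 2 + 4 * beta by rewrite /D; ring.
  by rewrite addr_ge0 ?sqr_ge0// mulr_ge0// ltW.
have S0 : 0 <= S by exact: sqrtr_ge0.
have SD : S ^+ 2 = D by exact: sqr_sqrtr.
have hS : S <= 1 + 2 * alpha - beta - 4 * r by lra.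
have : S ^+ 2 <= (1 + 2 * alpha - beta - 4 * r) ^+ 2.
  by apply: lerXn2r; rewrite ?nnegrE//; lra.
by rewrite SD /D; lra.
Qed.

End Assembly.

Unset Implicit Arguments.

Theorem theorem3p4 (R : realType) (alpha beta : R)
  (halpha : 4 / 5 <= alpha <= 1) (hbeta : 0 < beta < alpha) :
  R4 alpha beta < 1 / 2 /\
  forall f : C R -> C R, BA f ->
  forall z : C R, unit_disc z -> cmod z <= R4 alpha beta ->
    ((alpha * cmod (f z))%:E
      + beta%:E * \sum_(1 <= k <oo) (cmod (f^`(k)%classic z / k`!%:R) * cmod z ^+ k)%:E
     <= 1)%E.
Proof.
case/andP: halpha => _ a1; case/andP: hbeta => b0 ba.
have R4h := R4_lt_half alpha b0; split=> // f hf z zD zr.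
set r := cmod z in zr *; have r0 : 0 <= r by exact: cmod_ge0.
have r2 : r < 1 / 2 by exact: le_lt_trans R4h.
have hq := le_R4 b0 zr.
have x1 : cmod (f z) < 1 by case: hf => _; exact.
set x := cmod (f z) in x1 *; have x0 : 0 <= x by exact: cmod_ge0.
have B0 : 0 <= 1 - x ^+ 2 by rewrite subr_ge0 exprn_ile1// ltW.
have q0 : 0 < 1 - 2 * r by lra.
have bq : beta <= 1 - 2 * r.
  have r1 : 0 < 1 - r by lra.
  rewrite -(ler_pM2r r1); apply: le_trans hq _.
  by rewrite mulrC ler_pM2l//; lra.
have bt : beta * (r / (1 - 2 * r)) <= 1 / 2.
  by rewrite mulrA ler_pdivrMr//; nra.
have := taylor_sum_bound hf zD r2; rewrite -/r -/x => hs.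
apply: (@le_trans _ _ ((alpha * x)%:E + beta%:E * ((1 - x ^+ 2) * (r / (1 - 2 * r)))%:E)%E).
  by rewrite leeD2l// lee_wpmul2l// lee_fin ltW.
rewrite -EFinM -EFinD lee_fin mulrCA.
have h1 : (1 - x ^+ 2) * (beta * (r / (1 - 2 * r))) <= (1 - x ^+ 2) * (1 / 2).
  by rewrite ler_wpM2l.
have h2 : alpha * x <= x by rewrite ler_piMl.
have := sqr_ge0 (1 - x); lra.
Qed.
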